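(* Let $F_u(G,\Delta)$ be the uncertain system $\dot x_G=f(x_G,w,d)+g(x_G,w,d)u$, $v=h(x_G,w,d)$, $w=\Delta(v)$ on $[0,T]$, and let $F,H$ be the maps of the extended system with state $x=[x_G;x_\psi]\in\mathbb{R}^n$, $n=n_G+n_\psi$, as defined in the context. Let $T>0$, $R>0$, $\gamma\in\mathbb{R}$, $X_T\subset\mathbb{R}^{n_G}$, $P\in\mathbb{R}^{n_p\times n_u}$, $b\in\mathbb{R}^{n_p}$ be given, with control constraint set $U=\{u\in\mathbb{R}^{n_u}:Pu\le b\}$, and let the disturbances satisfy $\|d\|_{2,[0,T]}<R$. Let $\Psi$ and $M\in\mathbb{S}^{n_z}$ be given and assume that $\Delta$ satisfies the hard IQC defined by $(\Psi,M)$. Suppose there exist a $\mathcal{C}^1$ function $V:\mathbb{R}\times\mathbb{R}^{n}\to\mathbb{R}$ and a control law $k:\mathbb{R}\times\mathbb{R}^{n_G}\to\mathbb{R}^{n_u}$, continuous in $t$ and locally Lipschitz in $x_G$, such that: (i) for all $(t,x,w,d)\in[0,T]\times\mathbb{R}^n\times\mathbb{R}^{n_w}\times\mathbb{R}^{n_d}$ with $V(t,x)\le\gamma+R^2$, $$\partial_tV(t,x)+\partial_xV(t,x)\cdot F(x,w,d,k(t,x_G))+z^\top Mz\le d^\top d,\qquad z=H(x,w,d);$$ (ii) for every $x_\psi\in\mathbb{R}^{n_\psi}$, $\{x_G\in\mathbb{R}^{n_G}:V(T,[x_G;x_\psi])\le\gamma+R^2\}\subseteq X_T$; (iii) for every $i=1,\dots,n_p$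 and all $(t,x)\in[0,T]\times\mathbb{R}^n$ with $V(t,x)\le\gamma+R^2$, $P_i\,k(t,x_G)\le b_i$, where $P_i$ is the $i$-th row of $P$. Then the intersection of $\Omega^V_{0,\gamma}=\{x\in\mathbb{R}^n:V(0,x)\le\gamma\}$ with the hyperplane $x_\psi=0$, i.e. the set $\{\xi\in\mathbb{R}^{n_G}:V(0,[\xi;0])\le\gamma\}$, is an inner-approximation to $BRS(T,X_T,U,R,F_u(G,\Delta))$ under the control law $k$. That is, for every $\xi$ in this set and every $d$ with $\|d\|_{2,[0,T]}<R$, the solution of the uncertain system with $x_G(0)=\xi$ and $u(t)=k(t,x_G(t))$ satisfies $u(t)\in U$ for all $t\in[0,T]$ and $x_G(T)\in X_T$.
   Context: Signals and norms. $\mathcal{L}_2^{m}$ is the space of measurable $r:[0,\infty)\to\mathbb{R}^m$ with $\int_0^\infty r^\top r\,dt<\infty$; $\|r\|_{2,[0,T]}=(\int_0^T r(t)^\top r(t)\,dt)^{1/2}$, and $r\in\mathcal{L}_2^m[0,T]$ if this is finite. $\mathbb{S}^m$ denotes the real symmetric $m\times m$ matrices. $\mathbb{RH}_\infty$ denotes rational functions with real coefficients that are analytic in the closed right half plane (stable transfer functions). Uncertain system $F_u(G,\Delta)$. State $x_G(t)\in\mathbb{R}^{n_G}$, control $u(t)\in U\subseteq\mathbb{R}^{n_u}$, disturbance $d(t)\in\mathbb{R}^{n_d}$, and $v(t)\in\mathbb{R}^{n_v}$, $w(t)\in\mathbb{R}^{n_w}$ the input and output of the perturbation $\Delta$. The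 maps $f:\mathbb{R}^{n_G}\times\mathbb{R}^{n_w}\times\mathbb{R}^{n_d}\to\mathbb{R}^{n_G}$, $g:\mathbb{R}^{n_G}\times\mathbb{R}^{n_w}\times\mathbb{R}^{n_d}\to\mathbb{R}^{n_G\times n_u}$, $h:\mathbb{R}^{n_G}\times\mathbb{R}^{n_w}\times\mathbb{R}^{n_d}\to\mathbb{R}^{n_v}$ define the nominal system $G$. $\Delta:\mathcal{L}_2^{n_v}\to\mathcal{L}_2^{n_w}$ is a bounded, causal operator. Solutions. $x_G(t;\xi,u,d)$, $0\le t\le T$, denotes the solution of the uncertain system with initial condition $\xi$, control $u$ and disturbance $d$. Solutions are understood to exist on $[0,T]$: $x_G$ is absolutely continuous and satisfies the differential equation almost everywhere, $v\in\mathcal{L}_2^{n_v}[0,T]$, $w\in\mathcal{L}_2^{n_w}[0,T]$, and $w=\Delta(v)$ on $[0,T]$ (by causality, $v$ may be extended by zero beyond $T$). Statements about ''the solution'' apply to every such solution. Backward reachable set. $BRS(T,X_T,U,R,F_u(G,\Delta))$ is the set of $\xi\in\mathbb{R}^{n_G}$ for which there is a control $u$ with $u(t)\in U$ for all $t\in[0,T]$ and $x_G(T;\xi,u,d)\in X_T$ for all $d$ with $\|d\|_{2,[0,T]}<R$. Here the control may be given by feedback. Filter. $\Psi\in\mathbb{RH}_\infty^{n_z\times(n_v+n_w)}$ is an LTI system driven by $(v,w)$ with state $x_\psi(t)\in\mathbb{R}^{n_\psi}$, zero initial condition $x_\psi(0)=0$, and $\dot x_\psi=A_\psi x_\psi+B_{\psi1}v+B_{\psi2}w$,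 $z=C_\psi x_\psi+D_{\psi1}v+D_{\psi2}w\in\mathbb{R}^{n_z}$. Hard IQC. $\Delta$ satisfies the hard IQC defined by $(\Psi,M)$, $M\in\mathbb{S}^{n_z}$, if for all $v\in\mathcal{L}_2^{n_v}$ and $w=\Delta(v)$ the filter output $z$ satisfies $\int_0^t z(\tau)^\top Mz(\tau)\,d\tau\ge0$ for all $t\in[0,T]$. Extended system. With $x=[x_G;x_\psi]\in\mathbb{R}^n$, the interconnection of $G$ and $\Psi$ is $\dot x=F(x,w,d,u)$, $z=H(x,w,d)$, where $F(x,w,d,u)=\begin{bmatrix} f(x_G,w,d)+g(x_G,w,d)u\\ A_\psi x_\psi+B_{\psi1}h(x_G,w,d)+B_{\psi2}w\end{bmatrix}$ and $H(x,w,d)=C_\psi x_\psi+D_{\psi1}h(x_G,w,d)+D_{\psi2}w$. *)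

(* Defs.v *)
From HB Require Import structures.
From mathcomp Require Import all_boot all_order all_algebra.
From mathcomp Require Import fraction complex.
From mathcomp Require Import all_classical all_reals all_analysis.

Set Implicit Arguments.
Unset Strict Implicit.
Unset Printing Implicit Defensive.

Import Order.TTheory GRing.Theory Num.Theory.
Import numFieldNormedType.Exports.

Local Open Scope classical_set_scope.
Local Open Scope ring_scope.

Definition sqv (R : realType) (m : nat) (r : 'cV[R]_m) : R := (r^T *m r) 0 0.

Definition quad (R : realType) (m : nat) (M : 'M[R]_m) (z : 'cV[R]_m) : R :=
  (z^T *m M *m z) 0 0.

(* Signals are total functions of time; only their values on the time set under
   consideration matter. Measurability is required coordinatewise, i.e. for the
   Borel sigma-algebra of R^m. *)
Definition signal_measurable (R : realType) (m : nat) (D : set R)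
    (r : R -> 'cV[R]_m) : Prop :=
  forall i, measurable_fun D (fun t => r t i 0).

Definition L2norm (R : realType) (m : nat) (D : set R) (r : R -> 'cV[R]_m)
    : \bar R :=
  ((\int[@lebesgue_measure R]_(t in D) (sqv (r t))%:E) `^ 2^-1)%E.

Definition L2 (R : realType) (m : nat) (D : set R) (r : R -> 'cV[R]_m) : Prop :=
  signal_measurable D r /\
  (\int[@lebesgue_measure R]_(t in D) (sqv (r t))%:E < +oo)%E.

Definition trunc (R : realType) (m : nat) (tau : R) (r : R -> 'cV[R]_m)
    : R -> 'cV[R]_m :=
  patch (cst 0) `[0, tau] r.

Definition ae_eq_on (R : realType) (m : nat) (D : set R)
    (r s : R -> 'cV[R]_m) : Prop :=
  {ae @lebesgue_measure R, forall t, D t -> r t = s t}.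

(* An operator is a map on functions, of which only the action on L2 over
   [0, +oo[ is constrained. Causality is P_tau Delta = P_tau Delta P_tau, the
   equality being that of L2, hence almost everywhere. *)
Definition bounded_causal (R : realType) (nv nw : nat)
    (Delta : (R -> 'cV[R]_nv) -> (R -> 'cV[R]_nw)) : Prop :=
  [/\ forall v, L2 `[0, +oo[ v -> L2 `[0, +oo[ (Delta v),
      exists c : R, forall v, L2 `[0, +oo[ v ->
        (L2norm `[0%R, +oo[ (Delta v) <= c%:E * L2norm `[0%R, +oo[ v)%E
    & forall (tau : R) v, 0 <= tau -> L2 `[0, +oo[ v ->
        ae_eq_on `[0, tau] (Delta v) (Delta (trunc tau v))].

Definition abs_continuous (R : realType) (W : normedModType R) (a b : R)
    (f : R -> W) : Prop :=
  forall e : R, 0 < e -> exists2 delta : R, 0 < delta &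
    forall (N : nat) (l r : 'I_N -> R),
      (forall i, a <= l i /\ l i <= r i /\ r i <= b) ->
      (forall i j, i != j -> r i <= l j \/ r j <= l i) ->
      \sum_i (r i - l i) < delta ->
      \sum_i `|f (r i) - f (l i)| < e.

(* The endpoints of [0, T], where the two-sided derivative is not intrinsic to
   the restriction of x to [0, T], form a null set. *)
Definition caratheodory_solution (R : realType) (n : nat) (T : R)
    (x rhs : R -> 'cV[R]_n) : Prop :=
  abs_continuous 0 T x /\
  {ae @lebesgue_measure R, forall t : R, 0 <= t <= T -> is_derive t 1 x (rhs t)}.

Record nominal (R : realType) (nG nu nd nv nw : nat) := Nominal {
  fG : 'cV[R]_nG -> 'cV[R]_nw -> 'cV[R]_nd -> 'cV[R]_nG ;
  gG : 'cV[R]_nG -> 'cV[R]_nw -> 'cV[R]_nd -> 'M[R]_(nG, nu) ;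
  hG : 'cV[R]_nG -> 'cV[R]_nw -> 'cV[R]_nd -> 'cV[R]_nv }.

(* w = Delta v on [0, T], where v is extended by zero beyond T. *)
Definition uncertain_solution (R : realType) (nG nu nd nv nw : nat)
    (G : nominal R nG nu nd nv nw)
    (Delta : (R -> 'cV[R]_nv) -> (R -> 'cV[R]_nw)) (T : R)
    (xi : 'cV[R]_nG) (u : R -> 'cV[R]_nu) (d : R -> 'cV[R]_nd)
    (xG : R -> 'cV[R]_nG) (v : R -> 'cV[R]_nv) (w : R -> 'cV[R]_nw) : Prop :=
  [/\ xG 0 = xi,
      caratheodory_solution T xG
        (fun t => fG G (xG t) (w t) (d t) + gG G (xG t) (w t) (d t) *m u t),
      L2 `[0, T] v /\ L2 `[0, T] w,
      ae_eq_on `[0, T] v (fun t => hG G (xG t) (w t) (d t))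
    & ae_eq_on `[0, T] w (Delta (trunc T v))].

Definition disturbance (R : realType) (nd : nat) (T r : R)
    (d : R -> 'cV[R]_nd) : Prop :=
  L2 `[0, T] d /\ (L2norm `[0%R, T] d < r%:E)%E.

(* A control is a feedback law k; open-loop controls are the laws that do not
   depend on the state. The requirements bear on every solution. *)
Definition BRS_under (R : realType) (nG nu nd nv nw : nat) (T : R)
    (XT : set 'cV[R]_nG) (U : set 'cV[R]_nu) (r : R)
    (G : nominal R nG nu nd nv nw)
    (Delta : (R -> 'cV[R]_nv) -> (R -> 'cV[R]_nw))
    (k : R -> 'cV[R]_nG -> 'cV[R]_nu) : set 'cV[R]_nG :=
  [set xi | forall d xG v w, disturbance T r d ->
     uncertain_solution G Delta T xi (fun t => k t (xG t)) d xG v w ->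
     (forall t, 0 <= t <= T -> U (k t (xG t))) /\ XT (xG T)].

Definition BRS (R : realType) (nG nu nd nv nw : nat) (T : R)
    (XT : set 'cV[R]_nG) (U : set 'cV[R]_nu) (r : R)
    (G : nominal R nG nu nd nv nw)
    (Delta : (R -> 'cV[R]_nv) -> (R -> 'cV[R]_nw)) : set 'cV[R]_nG :=
  [set xi | exists k, BRS_under T XT U r G Delta k xi].

Record lti (R : realType) (nv nw nz npsi : nat) := LTI {
  Apsi : 'M[R]_npsi ;
  B1psi : 'M[R]_(npsi, nv) ;
  B2psi : 'M[R]_(npsi, nw) ;
  Cpsi : 'M[R]_(nz, npsi) ;
  D1psi : 'M[R]_(nz, nv) ;
  D2psi : 'M[R]_(nz, nw) }.

Definition lti_rhs (R : realType) (nv nw nz npsi : nat)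
    (Psi : lti R nv nw nz npsi)
    (x : 'cV[R]_npsi) (v : 'cV[R]_nv) (w : 'cV[R]_nw) : 'cV[R]_npsi :=
  Apsi Psi *m x + B1psi Psi *m v + B2psi Psi *m w.

Definition lti_out (R : realType) (nv nw nz npsi : nat)
    (Psi : lti R nv nw nz npsi)
    (x : 'cV[R]_npsi) (v : 'cV[R]_nv) (w : 'cV[R]_nw) : 'cV[R]_nz :=
  Cpsi Psi *m x + D1psi Psi *m v + D2psi Psi *m w.

Definition const_frac (R : realType) (m n : nat) (A : 'M[R]_(m, n))
    : 'M[{fraction {poly R}}]_(m, n) :=
  map_mx (fun c : R => tofrac c%:P) A.

(* C (s I - A)^-1 [B1 B2] + [D1 D2] over the field R(s); char_poly_mx A is
   the polynomial matrix s I - A. *)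
Definition transfer (R : realType) (nv nw nz npsi : nat)
    (Psi : lti R nv nw nz npsi) : 'M[{fraction {poly R}}]_(nz, nv + nw) :=
  const_frac (Cpsi Psi)
    *m invmx (map_mx (@tofrac {poly R}) (char_poly_mx (Apsi Psi)))
    *m const_frac (row_mx (B1psi Psi) (B2psi Psi))
  + const_frac (row_mx (D1psi Psi) (D2psi Psi)).

(* A rational function is analytic on the closed right half plane when some
   fraction representing it has a denominator without zeros there. *)
Definition RHinf (R : realType) (q : {fraction {poly R}}) : Prop :=
  exists num den : {poly R},
    q = tofrac num / tofrac den /\
    forall s : R[i], 0 <= complex.Re s ->
      ~~ root (map_poly (real_complex R) den) s.

Definition RHinf_mx (R : realType) (m n : nat)
    (Q : 'M[{fraction {poly R}}]_(m, n)) : Prop :=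
  forall i j, RHinf (Q i j).

Definition filter_state (R : realType) (nv nw nz npsi : nat)
    (Psi : lti R nv nw nz npsi) (T : R)
    (v : R -> 'cV[R]_nv) (w : R -> 'cV[R]_nw) (x : R -> 'cV[R]_npsi) : Prop :=
  x 0 = 0 /\
  caratheodory_solution T x (fun t => lti_rhs Psi (x t) (v t) (w t)).

Definition hard_IQC (R : realType) (nv nw nz npsi : nat) (T : R)
    (Psi : lti R nv nw nz npsi) (M : 'M[R]_nz)
    (Delta : (R -> 'cV[R]_nv) -> (R -> 'cV[R]_nw)) : Prop :=
  forall (v : R -> 'cV[R]_nv) (x : R -> 'cV[R]_npsi),
    L2 `[0, +oo[ v -> filter_state Psi T v (Delta v) x ->
    forall t : R, 0 <= t <= T ->
      (0 <= \int[@lebesgue_measure R]_(tau in `[0%R, t])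
              (quad M (lti_out Psi (x tau) (v tau) (Delta v tau)))%:E)%E.

Definition Fext (R : realType) (nG nu nd nv nw nz npsi : nat)
    (G : nominal R nG nu nd nv nw) (Psi : lti R nv nw nz npsi)
    (x : 'cV[R]_(nG + npsi)) (w : 'cV[R]_nw) (d : 'cV[R]_nd) (u : 'cV[R]_nu)
    : 'cV[R]_(nG + npsi) :=
  let xG := usubmx x in
  col_mx (fG G xG w d + gG G xG w d *m u)
         (lti_rhs Psi (dsubmx x) (hG G xG w d) w).

Definition Hext (R : realType) (nG nu nd nv nw nz npsi : nat)
    (G : nominal R nG nu nd nv nw) (Psi : lti R nv nw nz npsi)
    (x : 'cV[R]_(nG + npsi)) (w : 'cV[R]_nw) (d : 'cV[R]_nd) : 'cV[R]_nz :=
  lti_out Psi (dsubmx x) (hG G (usubmx x) w d) w.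

(* Jointly C^1 in (t, x). In finite dimension, continuity of the differential
   in operator norm is continuity of each directional derivative. *)
Definition C1 (R : realType) (n : nat) (V : R -> 'cV[R]_n -> R) : Prop :=
  let W := fun p : R * 'cV[R]_n => V p.1 p.2 in
  (forall p, differentiable W p) /\
  (forall h, continuous (fun p => 'd W p h)).

Definition admissible_law (R : realType) (n m : nat)
    (k : R -> 'cV[R]_n -> 'cV[R]_m) : Prop :=
  (forall x, continuous (fun t => k t x)) /\
  (forall t x0, exists2 e : R, 0 < e & [lipschitz k t x | x in ball x0 e]).

Definition polytope (R : realType) (np nu : nat)
    (P : 'M[R]_(np, nu)) (b : 'cV[R]_np) : set 'cV[R]_nu :=
  [set u | forall i, (P *m u) i 0 <= b i 0].

(* Main.v *)
(* Extend v by zero beyond T and run the filter on (v, Delta v); this needs the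
   solution of a linear ODE with L2 input, obtained by variation of constants with
   the matrix exponential. Along x = [xG; xpsi], the function V(t, x(t)) is
   absolutely continuous, and as long as it stays below gamma + r^2 the dissipation
   inequality bounds its derivative a.e. by d^T d - z^T M z. An absolutely
   continuous function with a.e. nonpositive derivative is nonincreasing, so by the
   hard IQC V(t, x(t)) <= V(0, x(0)) + int_0^t d^T d < gamma + r^2: the level is
   never reached, and the constraints on u and x(T) follow. *)

Require Import Defs.
From HB Require Import structures.
From mathcomp Require Import all_boot all_order all_algebra.
From mathcomp Require Import all_classical all_reals all_analysis.
From mathcomp Require Import measurable_realfun ring lra.

Import Order.TTheory GRing.Theory Num.Theory.
Import numFieldNormedType.Exports.

Local Open Scope classical_set_scope.
Local Open Scope ring_scope.

(** * Absolutely continuous functions *)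

(** The level argument is circular at face value: the dissipation inequality holds only where V(t,
    x(t)) <= gamma + r^2, which is what has to be proved. The circle is broken by induction along
    [0, T]: the estimate at t uses the inequality on ]0, t[ only and returns a strict bound, which
    continuity carries past t. The strictness comes from the strict bound on the norm of d. The same
    induction principle also derives monotonicity from a derivative sign known almost everywhere.
    V(t, x(t)) is compared with the indefinite integral of d^T d - z^T M z, which therefore has to
    be absolutely continuous with the expected derivative a.e. This requires z to be square
    integrable, hence a filter state that is continuous on [0, T] and filter inputs in L2. Finally,
    the IQC speaks of the truncated v and of its image under Delta, which match the signals of the
    plant only a.e., so all pointwise identities are collected on one set of full measure. *)

(** At the supremum of the points where [Q] holds, one step leads from a point at or just before it
    to a point beyond it, unless the supremum is [b]. As a step passes from before [t] to after [t]
    at once, [Q] needs to be neither monotone nor closed under limits. *)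
Lemma real_induction {R : realType} {a b : R} (Q : R -> Prop) : a <= b -> Q a ->
  (forall t, a <= t <= b -> exists2 e : R, 0 < e &
    forall s s', a <= s <= t -> t <= s' <= b -> t - e < s -> s' < t + e ->
      Q s -> Q s') ->
  Q b.
Proof.
move=> ab Qa step.
pose S := [set t | a <= t <= b /\ Q t].
have supS : has_sup S.
  by split; [exists a; rewrite /S /= lexx ab | exists b => x [/andP[]]].
have a_le : a <= sup S by apply: ub_le_sup; [exact: supS.2 | rewrite /S /= lexx ab].
have le_b : sup S <= b by apply: ge_sup; [exact: supS.1 | move=> x [/andP[]]].
have [|e e0 He] := step (sup S); first by rewrite a_le.
have [s [/andP[as_ sb] Qs] es] := sup_adherent e0 supS.
have s_le : s <= sup S by apply: ub_le_sup; [exact: supS.2 | split=> //; apply/andP].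
(* Half of [e] keeps [s'] strictly inside the window; once [s'] is known to lie in [S], the minimum
   can only be [b]. *)
set s' := Num.min b (sup S + e / 2).
have Qs' : Q s'.
  apply: (He s) => //; first by rewrite as_.
    by rewrite /s' ge_min lexx le_min le_b /= andbT; lra.
  by rewrite /s' gt_min; apply/orP; right; lra.
have s'_le : s' <= sup S.
  apply: ub_le_sup; [exact: supS.2 | split=> //].
  by rewrite /s' ge_min lexx le_min ab /= andbT; lra.
by move: Qs' s'_le; rewrite /s' /Num.min; case: ifP => // _ _ ?; lra.
Qed.

(* A point t where h' t <= 0 moves the front past t at rate at most e; a point of
   the null set moves it past t inside an open set O of small measure, where
   absolute continuity bounds the total increase. *)
Lemma ac_ae_nonincreasing {R : realType} {a b : R} (h : R -> R) : a <= b ->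
  abs_continuous a b h ->
  {ae @lebesgue_measure R, forall t, a < t < b ->
     exists2 l : R, l <= 0 & is_derive t 1 h l} ->
  h b <= h a.
Proof.
move=> ab ach [N [mN N0 sN]].
(* The term e (b - a) pays for the points with a derivative, the last e for the null set. *)
have e_ok : forall e : R, 0 < e -> h b <= h a + (e * (b - a) + e).
  move=> e e0.
  have [delta delta0 Hdelta] := ach e e0.
  (* The derivative is only assumed inside the open interval, so both endpoints join the exceptional
     set. *)
  pose N' := N `|` ([set a] `|` [set b]).
  have mN' : measurable N' by apply: measurableU => //; apply: measurableU.
  have muN' : lebesgue_measure N' = 0%E.
    apply/eqP; rewrite eq_le measure_ge0 andbT.
    apply: le_trans (measureU2 _ _ _) _ => //; first exact: measurableU.
    rewrite [X in (X + _)%E](_ : _ = 0%E) ?add0e; last exact: N0.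
    apply: le_trans (measureU2 _ _ _) _ => //.
    have S1 x : lebesgue_measure [set x : R] = 0%E by exact: lebesgue_measure_set1.
    by rewrite [X in (X + _)%E](S1 a : _ = 0%E) [X in (_ + X)%E](S1 b : _ = 0%E) adde0.
  have [|O [oO NO muO]] := lebesgue_regularity_outer mN' _ delta0.
    by rewrite [X in (X < _)%E](muN' : _ = 0%E) ltry.
  have mO : measurable O by exact: open_measurable.
  have {}muO : (lebesgue_measure O < delta%:E)%E.
    rewrite -(setDUK NO); apply: le_lt_trans (measureU2 _ _ _) _ => //.
      exact: measurableD.
    by rewrite [X in (X + _)%E](muN' : _ = 0%E) add0e.
  (* Invariant of the front t: the listed intervals are those on which it crossed exceptional
     points. Their total length is charged to the part of [O] swept so far, and outside them [h]
     grew at rate at most e. *)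
  pose Q t := exists n (l r : nat -> R),
    [/\ forall i, (i < n)%N -> a <= l i /\ l i <= r i /\ r i <= t,
        forall i j, (i < j)%N -> (j < n)%N -> r i <= l j,
        ((\sum_(i < n) (r i - l i))%:E <= lebesgue_measure (O `&` `[a, t]))%E
      & h t - h a <= e * (t - a) + \sum_(i < n) `|h (r i) - h (l i)|].
  have Qb : Q b.
    apply: (real_induction Q ab).
      by exists 0%N, (fun=> 0), (fun=> 0); split => //; rewrite !big_ord0 ?subrr ?mulr0 ?addr0.
    move=> t /andP[at_ tb].
    have [tN|tN] := pselect (N' t).
      have /nbhs_ballP[d d0 dO] : nbhs t O by apply: open_nbhs_nbhs; split => //; exact: NO.
      exists d => // s s' /andP[as_ st] /andP[ts' s'b] ds ds' [n [l [r [H1 H2 H3 H4]]]].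
      exists n.+1, (fun i => if (i < n)%N then l i else s),
        (fun i => if (i < n)%N then r i else s').
      split.
      - move=> i _; case: ifPn => [/H1[? [? ?]]|_]; last by split => //; split => //; lra.
        by split => //; split => //; lra.
      - move=> i j ij; rewrite ltnS leq_eqVlt => /orP[/eqP jn|jn].
          rewrite jn ltnn -jn ij.
          by have [_ [_ ?]] := H1 i (eq_rect j (fun k => (i < k)%N) ij n jn).
        by rewrite jn (ltn_trans ij jn); exact: H2.
      - rewrite big_ord_recr /= ltnn EFinD.
        under eq_bigr do rewrite ltn_ord.
        (* The new piece lies in [O] and is disjoint from what was swept up to [s], so the charges
           add up. *)
        have sub : (O `&` `[a, s]) `|` `]s, s'] `<=` O `&` `[a, s'].
          move=> x [[Ox]|]; rewrite /= !in_itv /= => /andP[? ?].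
            by split=> //; apply/andP; split => //; lra.
          split; last by apply/andP; split; lra.
          by apply: dO; rewrite /ball /= ltr_norml; apply/andP; split; lra.
        apply: le_trans (le_measure lebesgue_measure _ _ sub); last 2 first.
        + by rewrite inE; apply: measurableU => //; exact: measurableI.
        + by rewrite inE; exact: measurableI.
        rewrite measureU //; last 2 first.
        + exact: measurableI.
        + apply/seteqP; split => // x [[_]]; rewrite /= !in_itv /= => /andP[_ xs] /andP[sx _].
          by move: (lt_le_trans sx xs); rewrite ltxx.
        apply: leeD => //.
        rewrite [leRHS](lebesgue_measure_itv `]s, s'] : _ = _) /= lte_fin; case: ifPn => // ss'.
        by rewrite -leNgt in ss'; rewrite lee_fin; lra.
      - rewrite big_ord_recr /= ltnn.
        under eq_bigr do rewrite ltn_ord.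
        have := ler_norm (h s' - h s).
        have : e * (s - a) <= e * (s' - a) by rewrite ler_pM2l //; lra.
        lra.
    have : exists2 l : R, l <= 0 & is_derive t 1 h l.
      apply: contrapT => tl; apply: (tN); left; apply: (sN) => /= H; apply/tl/H.
      rewrite !lt_neqAle at_ tb !andbT; apply/andP; split; apply/eqP => ta.
        by apply: (tN); right; left.
      by apply: (tN); right; right.
    case=> l l0 [dh hl].
    have : (fun x => x^-1 *: (h (x *: 1 + t) - h t)) @ 0^' --> l.
      by rewrite -hl; exact: dh.
    move=> /cvgrPdist_lt /(_ e e0) /nbhs_ballP[d /= d0 Hd].
    have key x : t - d < x < t + d -> x != t -> (h x - h t) / (x - t) < e.
      move=> /andP[? ?] xt.
      have xb : ball (0 : R) d (x - t).
        by rewrite /ball /= sub0r normrN ltr_norml; apply/andP; split; lra.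
      have x0 : x - t != 0 by rewrite subr_eq0.
      have := Hd _ xb x0; rewrite /= [(x - t)%:A]mulr1 subrK ltr_distlC => /andP[_].
      rewrite [X in X < _ -> _]mulrC => ?; lra.
    exists d => // s s' /andP[as_ st] /andP[ts' s'b] ds ds' [n [l' [r [H1 H2 H3 H4]]]].
    exists n, l', r; split => //.
    - by move=> i /H1[? [? ?]]; split => //; split => //; lra.
    - apply: le_trans H3 _; apply: le_measure; rewrite ?inE; try exact: measurableI.
      by move=> x [Ox]; rewrite /= !in_itv /= => /andP[? ?]; split=> //; apply/andP; split; lra.
    (* The difference quotient is below e on both sides of [t] because its limit is nonpositive; the
       two halves of [s, s'] are estimated separately. *)
    - have A : h t - h s <= e * (t - s).
        have [->|st'] := eqVneq s t; first by rewrite !subrr mulr0.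
        have : (h s - h t) / (s - t) < e by apply: key => //; apply/andP; split; lra.
        have st0 : 0 < t - s by rewrite subr_gt0 lt_neqAle st'.
        rewrite -opprB -(opprB t s) invrN mulrNN ltr_pdivrMr //; exact: ltW.
      have B : h s' - h t <= e * (s' - t).
        have [->|st'] := eqVneq s' t; first by rewrite !subrr mulr0.
        have : (h s' - h t) / (s' - t) < e by apply: key => //; apply/andP; split; lra.
        have st0 : 0 < s' - t by rewrite subr_gt0 lt_neqAle eq_sym st'.
        by rewrite ltr_pdivrMr //; exact: ltW.
      lra.
  have [n [l [r [H1 H2 H3 H4]]]] := Qb.
  have := Hdelta n (l \o val) (r \o val) (fun i => H1 _ (ltn_ord i)) _ _ => /=.
  have Hd : forall i j : 'I_n, i != j -> r i <= l j \/ r j <= l i.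
    move=> i j; rewrite -val_eqE neq_ltn => /orP[ij|ij]; [left|right]; exact: H2.
  move=> /(_ Hd) H.
  have : \sum_(i < n) (r i - l i) < delta.
    rewrite -lte_fin; apply: le_lt_trans H3 (le_lt_trans _ muO).
    by apply: le_measure; rewrite ?inE //; exact: measurableI.
  move=> /H; lra.
apply/ler_addgt0Pr => e e0.
(* This rescaling makes the total error exactly e; the added 1 keeps the divisor positive when a =
   b. *)
have c0 : 0 < b - a + 1 by lra.
have := e_ok (e / (b - a + 1)) (divr_gt0 e0 c0).
suff -> : e / (b - a + 1) * (b - a) + e / (b - a + 1) = e by [].
by rewrite -{2}(mulr1 (e / _)) -mulrDr divfK // gt_eqF.
Qed.

#[local] Instance lebesgue_ae_filter {R : realType} :
  Filter (nbhs (almost_everywhere (@lebesgue_measure R))).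
Proof. exact: ae_filter_ringOfSetsType. Qed.

Lemma ac_subitv {R : realType} {W : normedModType R} {a b a' b' : R} (f : R -> W) :
  a <= a' -> b' <= b -> abs_continuous a b f -> abs_continuous a' b' f.
Proof.
move=> aa bb acf e /acf[d d0 H]; exists d => // n l r H1; apply: H => i.
by have [? [? ?]] := H1 i; split; [|split] => //; lra.
Qed.

(** Common source of the closure properties that follow: each reduces to a bound on increments.
    Taking f = g covers domination by a single function, and [|K| + 1] in the proof makes any sign
    of [K] acceptable. *)
Lemma ac_dominated {R : realType} {W W1 W2 : normedModType R} {a b : R} (K : R)
    (h : R -> W) (f : R -> W1) (g : R -> W2) :
  abs_continuous a b f -> abs_continuous a b g ->
  (forall s t, a <= s -> s <= t -> t <= b ->
     `|h t - h s| <= K * (`|f t - f s| + `|g t - g s|)) ->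
  abs_continuous a b h.
Proof.
move=> acf acg hfg e e0.
have K0 : 0 < `|K| + 1 by rewrite ltr_wpDl.
have [d1 d10 H1] := acf _ (divr_gt0 (divr_gt0 e0 K0) (ltr0n _ 2)).
have [d2 d20 H2] := acg _ (divr_gt0 (divr_gt0 e0 K0) (ltr0n _ 2)).
exists (Num.min d1 d2); first by rewrite lt_min d10.
move=> n l r lr disj; rewrite lt_min => /andP[/(H1 n l r lr disj) A /(H2 n l r lr disj) B].
apply: (@le_lt_trans _ _
    ((`|K| + 1) * (\sum_i `|f (r i) - f (l i)| + \sum_i `|g (r i) - g (l i)|))).
  rewrite -big_split /= mulr_sumr; apply: ler_sum => i _.
  have [? [? ?]] := lr i; apply: le_trans (hfg _ _ _ _ _) _ => //.
  by apply: ler_wpM2r; [rewrite addr_ge0 | rewrite (le_trans (ler_norm _)) // lerDl].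
rewrite -ltr_pdivlMl // mulrC (splitr (e / _)); exact: ltrD.
Qed.

Lemma ac_id {R : realType} (a b : R) : abs_continuous a b (@id R).
Proof.
move=> e e0; exists e => // n l r lr _; apply: le_lt_trans; apply: ler_sum => i _.
by rewrite ger0_norm // subr_ge0; have [_ []] := lr i.
Qed.

Lemma ac_sum {R : realType} {W : normedModType R} {a b : R} (I : Type) (s : seq I)
    (f : I -> R -> W) :
  (forall i, abs_continuous a b (f i)) ->
  abs_continuous a b (fun t => \sum_(i <- s) f i t).
Proof.
move=> acf; elim: s => [|i s IH].
  move=> e e0; exists 1 => // n l r _ _ _.
  by rewrite big1 // => j _; rewrite !big_nil subrr normr0.
apply: (ac_dominated 1 _ _ _ (acf i) IH) => u v _ _ _.
by rewrite mul1r !big_cons opprD addrACA ler_normD.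
Qed.

Lemma ac_continuous {R : realType} {W : normedModType R} {a b : R} (f : R -> W) :
  abs_continuous a b f -> {within `[a, b], continuous f}.
Proof.
move=> acf; apply/subspace_continuousP => t /=; rewrite in_itv /= => /andP[at_ tb].
apply/cvgrPdist_lt => e /acf[d d0 H]; rewrite near_withinE.
apply/nbhs_ballP; exists d => //= s ts; rewrite in_itv /= => /andP[as_ sb].
have [st|st] := leP s t.
- have := H 1%N (fun=> s) (fun=> t); rewrite !big_ord1; apply => //.
    by move=> i j; rewrite !ord1 eqxx.
  by move: ts; rewrite /ball /= ltr_norml => /andP[]; lra.
- have := H 1%N (fun=> t) (fun=> s); rewrite !big_ord1 distrC; apply.
  + by move=> _; split => //; split => //; exact: ltW.
  + by move=> i j; rewrite !ord1 eqxx.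
  by move: ts; rewrite /ball /= ltr_norml => /andP[]; lra.
Qed.

Lemma within_continuous_bounded {R : realType} {W : normedModType R} {a b : R} (f : R -> W) :
  {within `[a, b], continuous f} ->
  exists2 C : R, 0 < C & forall t, a <= t <= b -> `|f t| <= C.
Proof.
move=> /continuous_compact /(_ (@segment_compact _ a b)) /compact_bounded[M [_ HM]].
exists (`|M| + 1); first by rewrite ltr_wpDl.
move=> t tab; apply: HM; first by rewrite (le_lt_trans (ler_norm _)) // ltrDl.
by exists t => //=; rewrite in_itv.
Qed.

Lemma ac_mul {R : realType} {a b : R} (f g : R -> R) :
  abs_continuous a b f -> abs_continuous a b g ->
  abs_continuous a b (fun t => f t * g t).
Proof.
move=> acf acg.
have [C C0 HC] := within_continuous_bounded _ (ac_continuous _ acf).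
have [D D0 HD] := within_continuous_bounded _ (ac_continuous _ acg).
apply: (ac_dominated (C + D) _ _ _ acf acg) => s t as_ st tb.
have -> : f t * g t - f s * g s = f t * (g t - g s) + (f t - f s) * g s.
  by rewrite mulrBr mulrBl addrA subrK.
rewrite (le_trans (ler_normD _ _)) // !normrM mulrDr addrC; apply: lerD.
  rewrite mulrC ler_wpM2r //; have := HD s; rewrite as_ (le_trans st tb) => /(_ isT); lra.
rewrite ler_wpM2r //; have := HC t; rewrite tb (le_trans as_ st) => /(_ isT); lra.
Qed.

(** The increments add up to at most the integral of |f| over a union of intervals, which is small
    as soon as the measure of the union is. *)
Lemma ac_Rintegral {R : realType} (a b : R) (f : R -> R) :
  (@lebesgue_measure R).-integrable setT (EFin \o f) ->
  abs_continuous a b (fun t => \int[@lebesgue_measure R]_(s in `[a, t]) f s).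
Proof.
set mu := @lebesgue_measure R => intf e e0.
have [d [d0 Hd]] := integral_normr_continuous intf e0.
exists d => // n l r lr disj.
(* Neighbouring intervals may share an endpoint; taken half-open they are disjoint. *)
pose E (i : 'I_n) : set R := `]l i, r i]%classic.
have mE i : measurable (E i) by exact: measurable_itv.
have tE : trivIset [set` index_enum 'I_n] E.
  move=> i j _ _ [x []]; rewrite /E /= !in_itv /= => /andP[lx xr] /andP[lx' xr'].
  by apply: contrapT => /eqP /disj[|] ?; lra.
have intfS (A : set R) : measurable A -> mu.-integrable A (EFin \o f).
  by move=> mA; exact: integrableS intf.
have intnS (A : set R) : measurable A -> mu.-integrable A (EFin \o (fun x => `|f x|)).
  by move=> mA; apply: integrable_norm; exact: intfS.
have mU : measurable (\big[setU/set0]_i E i) by apply: bigsetU_measurable.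
move=> sum_lt.
apply: le_lt_trans (Hd _ mU _).
  rewrite /Rintegral (@ge0_integral_bigsetU _ _ _ mu _ E (EFin \o (fun x => `|f x|))) //=.
  - rewrite -sum_fine; last first.
      move=> i _; by apply: integrable_fin_num; [exact: mE | exact: (intnS (E i))].
    apply: ler_sum => i _; have [al [lr' rb]] := lr i.
    rewrite Rintegral_itvB ?bnd_simp //; last exact: intfS.
    by apply: le_normr_Rintegral => //; exact: intfS.
  - exact: index_enum_uniq.
  - by have /integrableP[] := intnS _ mU.
apply: le_lt_trans (_ : ((\sum_i (r i - l i))%:E < d%:E)%E); last by rewrite lte_fin.
apply: (@le_trans _ _ (\sum_i mu (E i))%E).
  elim: (index_enum _) => [|i s IH]; first by rewrite !big_nil [leLHS](measure0 mu).
  have mUs : measurable (\big[setU/set0]_(j <- s) E j) by apply: bigsetU_measurable.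
  rewrite !big_cons; apply: le_trans (measureU2 mu (mE i) mUs) _.
  by apply: leeD.
rewrite -sumEFin; apply: lee_sum => i _.
rewrite [leLHS](lebesgue_measure_itv `]l i, r i] : _ = _) /= lte_fin; case: ifPn => // _.
by rewrite lee_fin subr_ge0; have [_ []] := lr i.
Qed.

Lemma is_derive_Rintegral {R : realType} (a : R) (f : R -> R) :
  (@lebesgue_measure R).-integrable setT (EFin \o f) ->
  {ae @lebesgue_measure R, forall t, a < t ->
    is_derive t 1 (fun t => \int[@lebesgue_measure R]_(s in `[a, t]) f s) (f t)}.
Proof.
move=> intf.
have intfS (A : set R) : measurable A -> (@lebesgue_measure R).-integrable A (EFin \o f).
  by move=> mA; exact: integrableS intf.
have locf : locally_integrable [set: R] f.
  by apply: open_integrable_locally => //; exact: openT.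
have := @FTC1 R f (BLeft a) (fun y => intfS _ (measurable_itv _)) locf.
apply: filterS => t /= H at_; have [|d1 d2] := H _; first by rewrite lte_fin.
by split => //; rewrite -derive1E.
Qed.

(** * The matrix exponential *)

(* The power series of B e^(tA); the free factor B makes the family closed under
   differentiation, since (B e^(tA))' = (B A) e^(tA). *)
Definition mexp_coef {R : realType} {n : nat} (B A : 'M[R]_n) (i j : 'I_n) (k : nat) : R :=
  (B *m A ^+ k) i j / k`!%:R.

Definition mexp_mul {R : realType} {n : nat} (B A : 'M[R]_n) (t : R) : 'M[R]_n :=
  \matrix_(i, j) limn (pseries (mexp_coef B A i j) t).

Lemma mulmx_entry_le {R : realType} {n : nat} (B C : 'M[R]_n) (K : R) : 0 <= K ->
  (forall i j, `|C i j| <= K) ->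
  forall i j, `|(B *m C) i j| <= (\sum_a \sum_b `|B a b|) * K.
Proof.
move=> K0 CK i j; rewrite mxE (le_trans (ler_norm_sum _ _ _)) //.
apply: (@le_trans _ _ ((\sum_b `|B i b|) * K)).
  by rewrite mulr_suml; apply: ler_sum => l _; rewrite normrM ler_wpM2l.
rewrite ler_wpM2r // [leRHS](bigD1 i) //= lerDl.
by apply: sumr_ge0 => a _; apply: sumr_ge0.
Qed.

(** With c the sum of the absolute values of the entries of A, the entries of [A ^+ k] are at most
    c^k, so the series is dominated by a multiple of the exponential series at c |t|. *)
Lemma cvg_mexp_coef {R : realType} {n : nat} (B A : 'M[R]_n) i j t :
  cvgn (pseries (mexp_coef B A i j) t).
Proof.
pose c := \sum_a \sum_b `|A a b|; pose cB := \sum_a \sum_b `|B a b|.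
have ge0 (C : 'M[R]_n) : 0 <= \sum_a \sum_b `|C a b|.
  by apply: sumr_ge0 => a _; apply: sumr_ge0.
have powA k : forall i j, `|(A ^+ k) i j| <= c ^+ k.
  elim: k => [|k IH] a b; last first.
    by rewrite !exprS; apply: mulmx_entry_le => //; rewrite exprn_ge0 // ge0.
  by rewrite !expr0 mxE; case: eqP; rewrite /= ?normr0 ?normr1.
apply: normed_cvg.
apply: (@series_le_cvg _ _ (fun k => cB * exp_coeff (c * `|t|) k)) => /=.
- by move=> k; exact: normr_ge0.
- move=> k; rewrite mulr_ge0 ?ge0 // /exp_coeff /= divr_ge0 // exprn_ge0 //.
  by rewrite mulr_ge0 ?ge0.
- move=> k; rewrite /mexp_coef /exp_coeff /= !normrM normrX exprMn normfV normr_nat.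
  rewrite mulrAC -!mulrA mulrCA [in leRHS]mulrCA.
  rewrite [X in _ <= X](_ : _ = cB * c ^+ k * (`|t| ^+ k / k`!%:R)); last first.
    by rewrite mulrCA !mulrA.
  rewrite [X in X <= _](_ : _ = `|(B *m A ^+ k) i j| * (`|t| ^+ k / k`!%:R)); last first.
    by rewrite mulrCA mulrA.
  rewrite ler_wpM2r ?divr_ge0 ?exprn_ge0 //.
  by apply: mulmx_entry_le => //; rewrite exprn_ge0 // ge0.
- rewrite (_ : (fun k => _) = cB *: exp_coeff (c * `|t|)); last by apply/funext.
  by apply: is_cvg_seriesZ; exact: is_cvg_series_exp_coeff.
Qed.

Lemma mexp_mulE {R : realType} {n : nat} (B A : 'M[R]_n) t :
  mexp_mul B A t = B *m mexp_mul 1%:M A t.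
Proof.
apply/matrixP => i j; rewrite !mxE; apply/cvg_lim => //.
have -> : pseries (mexp_coef B A i j) t =
    (fun k => \sum_l B i l * pseries (mexp_coef 1%:M A l j) t k).
  apply/funext => k; rewrite /pseries /series /=.
  under [RHS]eq_bigr do rewrite mulr_sumr.
  rewrite exchange_big /=; apply: eq_bigr => m _.
  rewrite /mexp_coef mxE mulr_suml mulr_suml; apply: eq_bigr => l _.
  by rewrite mul1mx !mulrA.
under eq_bigr do rewrite mxE.
apply: (cvg_big add_continuous) => l _; apply: cvgM; first exact: cvg_cst.
exact: cvg_mexp_coef.
Qed.

(** A commutes with its powers; together with [mexp_mulE] this yields A e^(tA) = e^(tA) A. *)
Lemma mexp_mul_comm {R : realType} {n : nat} (A : 'M[R]_n) t :
  mexp_mul A A t = mexp_mul 1%:M A t *m A.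
Proof.
apply/matrixP => i j; rewrite !mxE; apply/cvg_lim => //.
have -> : pseries (mexp_coef A A i j) t =
    (fun k => \sum_l pseries (mexp_coef 1%:M A i l) t k * A l j).
  apply/funext => k; rewrite /pseries /series /=.
  under [RHS]eq_bigr do rewrite mulr_suml.
  rewrite exchange_big /=; apply: eq_bigr => m _.
  rewrite /mexp_coef -[A *m A ^+ m]/(A * A ^+ m) -exprS exprSr -[_ * A]/(_ *m A).
  rewrite mxE !mulr_suml; apply: eq_bigr => l _.
  by rewrite mul1mx; ring.
under eq_bigr do rewrite mxE.
apply: (cvg_big add_continuous) => l _; apply: cvgM; last exact: cvg_cst.
exact: cvg_mexp_coef.
Qed.

Lemma mexp_mul0 {R : realType} {n : nat} (B A : 'M[R]_n) : mexp_mul B A 0 = B.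
Proof.
apply/matrixP => i j; rewrite !mxE; apply/cvg_lim => //.
(* The partial sum of length 0 is empty; after the shift every partial sum contains the constant
   term and equals it. *)
rewrite -(cvg_shiftn 1) (_ : (fun k => _) = cst (B i j)); first exact: cvg_cst.
apply/funext => k; rewrite /pseries /series /= addn1 big_nat_recl //= big1 ?addr0.
  by rewrite /mexp_coef expr0 mulmx1 fact0 divr1 expr0 mulr1.
by move=> l _; rewrite expr0n mulr0.
Qed.

Lemma is_derive_mexp {R : realType} {n : nat} (B A : 'M[R]_n) i j (t : R) :
  is_derive t 1 (fun t => mexp_mul B A t i j) (mexp_mul (B *m A) A t i j).
Proof.
have diffsE C : pseries_diffs (mexp_coef C A i j) = mexp_coef (C *m A) A i j.
  apply/funext => k; rewrite /pseries_diffs /mexp_coef factS natrM invfM.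
  rewrite mulrCA [_%:R * _]mulrA divff ?pnatr_eq0 // mul1r exprS.
  by rewrite -[A * _]/(A *m _) mulmxA.
have -> : (fun t => mexp_mul B A t i j) = (fun t => limn (pseries (mexp_coef B A i j) t)).
  by apply/funext => s; rewrite mxE.
rewrite mxE -diffsE.
(* Termwise differentiation asks for convergence at a point of modulus larger than |t|; the series
   converges everywhere, so any such point will do. *)
apply: (@pseries_snd_diffs _ _ (`|t| + 1)); rewrite ?diffsE; try exact: cvg_mexp_coef.
by rewrite [ltRHS]ger0_norm ?addr_ge0 // ltrDl.
Qed.

(** The derivative of e^(tA) e^(-tA) is A e^(tA) e^(-tA) - e^(tA) A e^(-tA), which vanishes by
    commutation, and the value at 0 is the identity. *)
Lemma mexp_inverse {R : realType} {n : nat} (A : 'M[R]_n) t :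
  mexp_mul 1%:M A t *m mexp_mul 1%:M A (- t) = 1%:M.
Proof.
set E := mexp_mul 1%:M A.
apply/matrixP => i j.
rewrite -[in RHS](mul1mx 1%:M) -[in RHS](mexp_mul0 1%:M A) -{2}oppr0 -/E.
apply: (@is_derive_0_is_cst _ (fun t => (E t *m E (- t)) i j)) => s.
have -> : (fun t => (E t *m E (- t)) i j) =
    \sum_l ((fun t => E t i l) * ((fun t => E t l j) \o -%R)).
  by apply/funext => u; rewrite mxE fct_sumE; apply: eq_bigr.
have dE l m u : is_derive u (1 : R) (fun t => E t l m) ((A *m E u) l m).
  by rewrite -mexp_mulE; have := is_derive_mexp 1%:M A l m u; rewrite mul1mx.
have dEN l : is_derive s (1 : R) ((fun t => E t l j) \o -%R) ((A *m E (- s)) l j * -1).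
  exact: is_derive1_comp.
apply: (is_derive_eq (is_derive_sum (fun l => is_deriveM (dE i l s) (dEN l)))).
rewrite big_split /=.
rewrite (_ : \sum_l E s i l *: _ = - (E s *m (A *m E (- s))) i j); last first.
  by rewrite mxE -sumrN; apply: eq_bigr => l _; rewrite mulrN1 scalerN.
rewrite (_ : \sum_l E (- s) l j *: _ = ((A *m E s) *m E (- s)) i j); last first.
  by rewrite mxE; apply: eq_bigr => l _; rewrite [LHS]mulrC.
have -> : A *m E s = E s *m A by rewrite -mexp_mulE mexp_mul_comm.
by rewrite mulmxA addNr.
Qed.

Lemma is_derive_mx {R : realFieldType} {V : normedModType R} {m n : nat}
    (f : V -> 'M[R]_(m, n)) (df : 'M[R]_(m, n)) (t v : V) :
  (forall i j, is_derive t v (fun s => f s i j) (df i j)) -> is_derive t v f df.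
Proof.
move=> H; have D : derivable f t v by apply/derivable_mxP => i j; exact: ex_derive.
split => //; rewrite derive_mx //; apply/matrixP => i j; rewrite mxE.
exact: derive_val.
Qed.

Lemma is_derive_coord {R : realFieldType} {V : normedModType R} {m n : nat}
    (f : V -> 'M[R]_(m, n)) (df : 'M[R]_(m, n)) (t v : V) i j :
  is_derive t v f df -> is_derive t v (fun s => f s i j) (df i j).
Proof.
move=> [dft e]; split; first by move/derivable_mxP : dft.
by rewrite -e derive_mx // mxE.
Qed.

Lemma normmx_entry_le {R : realType} {m n : nat} (A : 'M[R]_(m, n)) i j :
  `|A i j| <= `|A|.
Proof. by rewrite [leRHS]/Num.norm /= mx_normrE; exact: (le_bigmax _ _ (i, j)). Qed.

Lemma ac_mx {R : realType} {a b : R} {m n : nat} (f : R -> 'M[R]_(m, n)) :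
  (forall i j, abs_continuous a b (fun t => f t i j)) -> abs_continuous a b f.
Proof.
move=> acf.
have ac1 (l : 'I_m * 'I_n) : abs_continuous a b
    (fun t => f t l.1 l.2 *: delta_mx l.1 l.2 : 'M[R]_(m, n)).
  apply: (ac_dominated `|delta_mx l.1 l.2 : 'M[R]_(m, n)| _ _ _ (acf l.1 l.2) (acf l.1 l.2)).
  move=> s t _ _ _; rewrite -scalerBl normrZ mulrC ler_wpM2l //.
  by rewrite lerDl.
have := ac_sum _ (index_enum ('I_m * 'I_n)%type) _ ac1.
rewrite (_ : (fun t => _) = f) //; apply/funext => t.
by rewrite [RHS]matrix_sum_delta pair_bigA.
Qed.

(** * Linear differential equations *)

Lemma is_derive_continuous {R : realType} (f df : R -> R) :
  (forall t : R, is_derive t (1 : R) f (df t)) -> continuous f.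
Proof.
move=> H t; apply: differentiable_continuous; apply/derivable1_diffP.
by have [] := H t.
Qed.

(** The derivative is bounded on the compact interval, so the mean value theorem makes f Lipschitz
    there. *)
Lemma ac_C1 {R : realType} {a b : R} (f df : R -> R) : a <= b ->
  (forall t : R, is_derive t (1 : R) f (df t)) -> continuous df -> abs_continuous a b f.
Proof.
move=> ab H cdf.
have [C C0 HC] := within_continuous_bounded df
  (continuous_subspaceT cdf : {within `[a, b], continuous df}).
apply: (ac_dominated C _ _ _ (ac_id a b) (ac_id a b)) => s t as_ st tb.
have [|c cst ->] := MVT_segment st (fun x _ => H x).
  by apply: continuous_subspaceT; exact: is_derive_continuous H.
rewrite normrM; apply: ler_pM => //; last by rewrite lerDl.
by move: cst; rewrite in_itv /= => /andP[? ?]; apply: HC; apply/andP; split; lra.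
Qed.

Lemma integrable_mul_continuous {R : realType} {a b : R} (f g : R -> R) :
  continuous g -> (@lebesgue_measure R).-integrable `[a, b] (EFin \o f) ->
  (@lebesgue_measure R).-integrable `[a, b] (EFin \o (fun t => g t * f t)).
Proof.
move=> cg intf.
have [C C0 HC] := within_continuous_bounded g
  (continuous_subspaceT cg : {within `[a, b], continuous g}).
have := @integrableMl _ _ _ (@lebesgue_measure R) `[a, b] (measurable_itv _) (EFin \o f) g intf.
rewrite (_ : ((EFin \o f) \* (EFin \o g))%E = EFin \o (fun t => g t * f t)); last first.
  by apply/funext => t /=; rewrite -EFinM mulrC.
apply.
- by apply: measurable_funTS; exact: continuous_measurable_fun.
- exists C; split; first exact: num_real.
  move=> M CM t /=; rewrite in_itv /= => /HC /le_trans; apply; exact: ltW.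
Qed.

Lemma integrable_EFin_sum {R : realType} {D : set R} (I : Type) (s : seq I)
    (f : I -> R -> R) : measurable D ->
  (forall i, (@lebesgue_measure R).-integrable D (EFin \o f i)) ->
  (@lebesgue_measure R).-integrable D (EFin \o (fun t => \sum_(i <- s) f i t)).
Proof.
move=> mD intf.
elim: s => [|i s IH].
  rewrite (_ : EFin \o _ = cst 0%E); first exact: integrable0.
  by apply/funext => t /=; rewrite big_nil.
rewrite (_ : EFin \o _ = ((EFin \o f i) \+ (EFin \o (fun t => (\sum_(j <- s) f j t)%R)))%E).
  exact: integrableD.
by apply/funext => t /=; rewrite big_cons.
Qed.

(* Variation of constants: x = e^(tA) * int_0^t e^(-sA) q. *)
Lemma linear_ode_solution {R : realType} {n : nat} (T : R) (A : 'M[R]_n)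
    (q : R -> 'cV[R]_n) : 0 <= T ->
  (forall i, (@lebesgue_measure R).-integrable `[0, T] (EFin \o (fun t => q t i 0))) ->
  exists x : R -> 'cV[R]_n, x 0 = 0 /\
    caratheodory_solution T x (fun t => A *m x t + q t).
Proof.
set mu := @lebesgue_measure R => T0 intq.
pose E := mexp_mul 1%:M A.
have dE t i j : is_derive t (1 : R) (fun t => E t i j) ((A *m E t) i j).
  by rewrite -mexp_mulE; have := is_derive_mexp 1%:M A i j t; rewrite mul1mx.
have cE i j : continuous (fun t => E t i j) := is_derive_continuous _ _ (fun t => dE t i j).
have cEN i j : continuous (fun t => E (- t) i j).
  move=> t; apply: (@continuous_comp _ _ _ -%R (fun t => E t i j)).
    exact: opp_continuous.
  exact: cE.
have acE i j : abs_continuous 0 T (fun t => E t i j).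
  apply: (ac_C1 _ _ T0 (fun t => dE t i j)).
  rewrite (_ : (fun t => _) = (fun t => \sum_l A i l * E t l j)); last first.
    by apply/funext => t; rewrite mxE.
  apply: (continuous_big add_continuous) => l _ t.
  by apply: cvgM; [exact: cvg_cst | exact: cE].
pose f i (t : R) : R := (E (- t) *m q t) i 0.
(* Extension by zero: the lemmas on indefinite integrals ask for integrability on the whole line. *)
have intf i : mu.-integrable setT (EFin \o (f i \_ `[0, T]%classic)).
  suff : mu.-integrable `[0, T] (EFin \o f i) by rewrite integrable_mkcond // restrict_EFin.
  rewrite (_ : f i = fun t => \sum_l E (- t) i l * q t l 0); last first.
    by apply/funext => t; rewrite /f mxE.
  by apply: integrable_EFin_sum => // l; exact: integrable_mul_continuous.
pose y i (t : R) : R := \int[mu]_(s in `[0, t]) (f i \_ `[0, T]%classic) s.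
pose Y t : 'cV[R]_n := \col_i y i t.
have dY : {ae mu, forall t : R, 0 < t -> t <= T -> is_derive t (1 : R) Y (E (- t) *m q t)}.
  have : {ae mu, forall t : R, forall i, 0 < t ->
      is_derive t (1 : R) (y i) ((f i \_ `[0, T]%classic) t)}.
    by apply: filter_forall => i; exact: is_derive_Rintegral.
  apply: filterS => t Ht t0 tT; apply: is_derive_mx => i j.
  rewrite ord1 (_ : (fun s => Y s i 0) = y i); last by apply/funext => s; rewrite mxE.
  have := Ht i t0; rewrite patchE mem_set //= in_itv /= tT andbT; exact: ltW.
exists (fun t => E t *m Y t); split.
  rewrite [Y 0](_ : _ = 0) ?mulmx0 //; apply/matrixP => i j; rewrite !mxE /y.
  by rewrite set_itv1 Rintegral_set1.
split.
  apply: ac_mx => i j.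
  rewrite (_ : (fun t => _) = (fun t => \sum_l E t i l * y l t)); last first.
    by apply/funext => t; rewrite mxE; apply: eq_bigr => l _; rewrite [Y t l j]mxE.
  by apply: ac_sum => l; apply: ac_mul => //; exact: ac_Rintegral.
(* The derivative of [Y] is available for t > 0 only; the remaining point 0 is discarded as a null
   set. *)
have ne0 : {ae mu, forall t : R, t != 0}.
  exists [set 0]; split => //; first exact: lebesgue_measure_set1.
  by move=> t /= /negP; rewrite negbK => /eqP.
apply: filterS2 dY ne0 => t dYt t0 /andP[t_ge tT].
have {}dYt : is_derive t (1 : R) Y (E (- t) *m q t) by apply: dYt => //; rewrite lt_neqAle eq_sym t0.
apply: is_derive_mx => i j.
have dYl l : is_derive t (1 : R) (fun s => Y s l j) ((E (- t) *m q t) l j) by exact: is_derive_coord.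
have -> : (fun s => (E s *m Y s) i j) = \sum_l ((fun s => E s i l) * (fun s => Y s l j)).
  by apply/funext => s; rewrite mxE fct_sumE.
apply: (is_derive_eq (is_derive_sum (fun l => is_deriveM (dE t i l) (dYl l)))).
rewrite big_split /= addrC mxE; congr (_ + _).
  by rewrite mulmxA mxE; apply: eq_bigr => l _; rewrite [LHS]mulrC.
have qE : q t = E t *m (E (- t) *m q t) by rewrite mulmxA mexp_inverse mul1mx.
by rewrite [in RHS]qE [RHS]mxE.
Qed.

(** * C1 functions along absolutely continuous curves *)

Lemma is_derive_diff_comp {R : realFieldType} {V : normedModType R} (W : V -> R)
    (c : R -> V) (t : R) (dc : V) :
  is_derive t (1 : R) c dc -> differentiable W (c t) ->
  is_derive t (1 : R) (W \o c) ('d W (c t) dc).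
Proof.
move=> [dct cE] dW.
have dc' : differentiable c t by apply/derivable1_diffP.
have dWc : differentiable (W \o c) t by exact: differentiable_comp.
split; first exact/derivable1_diffP.
by rewrite deriveE // diff_comp //= -(deriveE _ dc') cE.
Qed.

Lemma is_derive_graph {R : realFieldType} {V : normedModType R}
    (c : R -> V) (t : R) (dc : V) :
  is_derive t (1 : R) c dc ->
  is_derive t (1 : R) (fun s => (s, c s) : R * V) (1 : R, dc).
Proof.
move=> [dct cE].
have dc' : differentiable c t by apply/derivable1_diffP.
have di : differentiable (id : R -> R) t by [].
have dg : differentiable (fun s => (s, c s) : R * V) t := differentiable_pair di dc'.
split; first exact/derivable1_diffP.
by rewrite deriveE // (diff_pair di dc') -(deriveE _ dc') -(deriveE _ di) cE derive_id.
Qed.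

(** Link between [C1], phrased with the joint differential, and the separate partial derivatives of
    the dissipation inequality, by linearity from (1, dx) = (1, 0) + (0, dx). *)
Lemma diff_partials {R : realFieldType} {n : nat} (V : R -> 'cV[R]_n -> R) (t : R)
    (x dx : 'cV[R]_n) :
  differentiable (fun p : R * 'cV[R]_n => V p.1 p.2) (t, x) ->
  'd (fun p : R * 'cV[R]_n => V p.1 p.2) (t, x) (1, dx) =
    derive1 (fun s => V s x) t + 'd (V t) x dx.
Proof.
set W := fun p : R * 'cV[R]_n => V p.1 p.2 => dW.
have -> : (1, dx) = (1, 0) + (0, dx) :> R * 'cV[R]_n.
  by congr (_, _); rewrite /= ?addr0 ?add0r.
rewrite linearD; congr (_ + _).
  rewrite derive1E; apply/esym/derive_val.
  by apply: (is_derive_diff_comp W (fun s => (s, x))) => //; apply: is_derive_graph.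
have dj : is_diff x (fun y : 'cV[R]_n => (t, y) : R * 'cV[R]_n) (fun y => (0, y)) by exact: is_diff_eq.
rewrite -[V t]/(W \o (fun y : 'cV[R]_n => (t, y) : R * 'cV[R]_n)).
by rewrite diff_comp //= diff_val.
Qed.

(** For the maximum norm the ball is a product of segments; compactness for row vectors is carried
    to columns by transposition. *)
Lemma bounded_box_compact {R : realType} {n : nat} (M : R) :
  compact [set p : R * 'cV[R]_n | `|p| <= M].
Proof.
pose K := [set v : 'rV[R]_n | forall i, `[- M, M]%classic (v ord0 i)].
have cK : compact K := (@rV_compact R n (fun=> `[- M, M]%classic) (fun _ => @segment_compact R (- M) M)).
have ct : continuous (trmx : 'rV[R]_n -> 'cV[R]_n).
  move=> v B /nbhs_ballP[e e0 eB]; apply/nbhs_ballP; exists e => // w [_ vw].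
  by apply: eB; split => // i j; rewrite !mxE; exact: vw.
have c2 := compact_setX (@segment_compact R (- M) M)
  (continuous_compact (continuous_subspaceT ct : {within K, continuous trmx}) cK).
rewrite (_ : [set p | _] = `[- M, M]%classic `*` [set v^T | v in K]) //.
apply/seteqP; split => [[s x]|[s x]] /=; rewrite prod_normE ge_max /=.
  move=> /andP[sM xM]; split; first by rewrite in_itv /= -ler_norml.
  exists x^T; last exact: trmxK.
  move=> i; rewrite /= in_itv /= -ler_norml mxE.
  exact: le_trans (normmx_entry_le _ _ _) xM.
move=> [+ [v Kv <-]]; rewrite in_itv /= -ler_norml => sM; rewrite sM /=.
rewrite [leLHS]/Num.norm /= mx_normrE; apply: bigmax_le => [|[i j] _ /=].
  exact: le_trans sM.
by rewrite mxE ord1; have := Kv i; rewrite /= in_itv /= -ler_norml.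
Qed.

(** Each of the finitely many basis directional derivatives is bounded on the compact box. By
    linearity this bounds the whole differential, and the mean value theorem applies along
    segments. *)
Lemma C1_lipschitz {R : realType} {n : nat} (V : R -> 'cV[R]_n -> R) (M : R) : C1 V ->
  exists L : R, forall (s t : R) (x y : 'cV[R]_n),
    `|s| <= M -> `|t| <= M -> `|x| <= M -> `|y| <= M ->
    `|V t y - V s x| <= L * (`|t - s| + `|y - x|).
Proof.
set W := fun p : R * 'cV[R]_n => V p.1 p.2 => -[dW cW].
have bnd h : exists2 C : R, 0 <= C & forall p : R * 'cV[R]_n, `|p| <= M -> `|'d W p h| <= C.
  have /compact_bounded[B [_ HB]] := continuous_compact
    (continuous_subspaceT (cW h)) (@bounded_box_compact R n M).
  exists (`|B| + 1); first by rewrite addr_ge0.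
  move=> p pM; apply: HB; first by rewrite (le_lt_trans (ler_norm _)) // ltrDl.
  by exists p.
have [C0 C00 HC0] := bnd (1, 0).
have /choice[C HC] : forall i : 'I_n, exists c, 0 <= c /\
    forall p : R * 'cV[R]_n, `|p| <= M -> `|'d W p (0, delta_mx i 0)| <= c.
  by move=> i; have [c ? ?] := bnd (0, delta_mx i 0); exists c.
have dW_le p h : `|p| <= M -> `|'d W p h| <= (C0 + \sum_i C i) * (`|h.1| + `|h.2|).
  move=> pM; case: h => h1 h2 /=.
  have -> : (h1, h2) = h1 *: (1, 0) + \sum_i h2 i 0 *: (0, delta_mx i 0) :> R * 'cV[R]_n.
    have -> : \sum_i h2 i 0 *: ((0, delta_mx i 0) : R * 'cV[R]_n) = (0, h2).
      rewrite [in RHS](matrix_sum_delta h2).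
      elim/big_rec2: _ => // i v u _ ->.
      by rewrite big_ord1; congr (_, _); rewrite /= ?scaler0 ?addr0.
    by congr (_, _); rewrite /= ?scaler0 ?add0r // addr0 [RHS]mulr1.
  rewrite linearD linearZ linear_sum (le_trans (ler_normD _ _)) //.
  rewrite mulrDl; apply: lerD.
    rewrite normrM mulrC; apply: ler_pM => //; first exact: HC0.
    by rewrite lerDl.
  rewrite (le_trans (ler_norm_sum _ _ _)) // mulr_suml; apply: ler_sum => i _.
  rewrite linearZ normrM mulrC; have [? HCi] := HC i; apply: ler_pM => //; first exact: HCi.
  by rewrite (le_trans (normmx_entry_le _ i 0)) // lerDr.
exists (C0 + \sum_i C i) => s t x y sM tM xM yM.
pose c (l : R) : R * 'cV[R]_n := (s, x) + l *: ((t, y) - (s, x)).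
have dc l : is_derive l (1 : R) c ((t, y) - (s, x)).
  have dlin : is_derive l (1 : R) (fun l : R => l *: ((t, y) - (s, x)) : R * 'cV[R]_n)
      ((t, y) - (s, x)).
    split.
      by apply/derivable1_diffP; exact: differentiableZl.
    rewrite deriveE; last exact: differentiableZl.
    by rewrite diffZl //= diff_val scale1r.
  apply: is_derive_eq.
  by rewrite add0r.
have dWc l : is_derive l (1 : R) (W \o c) ('d W (c l) ((t, y) - (s, x))).
  exact: is_derive_diff_comp.
have [|l l01] := MVT_segment (ler01 : 0 <= 1 :> R) (fun l _ => dWc l).
  by apply: continuous_subspaceT; exact: is_derive_continuous dWc.
rewrite subr0 mulr1 /= /c scale1r scale0r addr0 addrCA subrr addr0 => ->.
apply: le_trans (dW_le _ _ _) _ => //.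
move: l01; rewrite in_itv /= => /andP[l0 l1].
have -> : (s, x) + l *: ((t, y) - (s, x)) =
    ((1 - l) *: s + l *: t, (1 - l) *: x + l *: y) :> R * 'cV[R]_n.
  by congr (_, _); rewrite /= scalerBr scalerBl scale1r addrA addrAC.
(* Convexity: the intermediate point given by the mean value theorem stays in the box where the
   differential is bounded. *)
have conv (U : normedModType R) (u v : U) :
    `|u| <= M -> `|v| <= M -> `|(1 - l) *: u + l *: v| <= M.
  move=> uM vM; rewrite (le_trans (ler_normD _ _)) // !normrZ !ger0_norm ?subr_ge0 //.
  rewrite [leRHS](_ : M = (1 - l) * M + l * M); last by rewrite mulrBl mul1r subrK.
  by apply: lerD; apply: ler_wpM2l => //; rewrite subr_ge0.
by rewrite prod_normE /= ge_max !conv.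
Qed.

Lemma ac_C1_graph {R : realType} {n : nat} {a b : R} (V : R -> 'cV[R]_n -> R)
    (x : R -> 'cV[R]_n) :
  C1 V -> abs_continuous a b x -> abs_continuous a b (fun t => V t (x t)).
Proof.
move=> hV acx.
have [C _ HC] := within_continuous_bounded _ (ac_continuous _ acx).
have [D _ HD] := within_continuous_bounded _ (ac_continuous _ (ac_id a b)).
have [L HL] := C1_lipschitz V (Num.max C D) hV.
apply: (ac_dominated L _ _ _ (ac_id a b) acx) => s t as_ st tb.
have sab : a <= s <= b by rewrite as_ (le_trans st).
have tab : a <= t <= b by rewrite tb (le_trans as_).
by apply: HL; rewrite le_max ?HC ?HD ?orbT.
Qed.

(** * Square-integrable signals *)

Definition square_integrable {R : realType} (D : set R) (f : R -> R) : Prop :=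
  measurable_fun D f /\ (@lebesgue_measure R).-integrable D (EFin \o (fun t => f t ^+ 2)).

Lemma square_integrable_mul {R : realType} (D : set R) (f g : R -> R) : measurable D ->
  square_integrable D f -> square_integrable D g ->
  (@lebesgue_measure R).-integrable D (EFin \o (fun t => f t * g t)).
Proof.
move=> mD [mf intf] [mg intg].
apply: le_integrable (integrableD _ intf intg) => //.
  by apply/measurable_EFinP; exact: measurable_funM.
move=> t _ /=; rewrite lee_fin [leRHS]ger0_norm ?addr_ge0 ?sqr_ge0 //.
rewrite normrM -(real_normK (num_real (f t))) -(real_normK (num_real (g t))).
have := sqr_ge0 (`|f t| - `|g t|); have := mulr_ge0 (normr_ge0 (f t)) (normr_ge0 (g t)).
nra.
Qed.

Lemma square_integrableD {R : realType} (D : set R) (f g : R -> R) : measurable D ->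
  square_integrable D f -> square_integrable D g ->
  square_integrable D (fun t => f t + g t).
Proof.
move=> mD [mf intf] [mg intg]; split; first exact: measurable_funD.
(* The dominating function is 2 (f^2 + g^2), written as a sum. *)
apply: le_integrable (integrableD _ (integrableD _ intf intg) (integrableD _ intf intg)) => //.
  by apply/measurable_EFinP; apply: measurable_funX; exact: measurable_funD.
move=> t _ /=; rewrite lee_fin !ger0_norm ?addr_ge0 ?sqr_ge0 //.
have := sqr_ge0 (f t - g t); nra.
Qed.

Lemma square_integrableZ {R : realType} (D : set R) (c : R) (f : R -> R) : measurable D ->
  square_integrable D f -> square_integrable D (fun t => c * f t).
Proof.
move=> mD [mf intf]; split; first exact: measurable_funM.
rewrite (_ : EFin \o _ = (fun t => (c ^+ 2)%R%:E * (EFin \o (fun t => (f t ^+ 2)%R)) t)%E).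
  exact: integrableZl.
by apply/funext => t /=; rewrite exprMn EFinM.
Qed.

Lemma square_integrable_sum {R : realType} (D : set R) (I : Type) (s : seq I)
    (f : I -> R -> R) : measurable D ->
  (forall i, square_integrable D (f i)) ->
  square_integrable D (fun t => \sum_(i <- s) f i t).
Proof.
move=> mD sf; elim: s => [|i s IH].
  rewrite (_ : (fun t => _) = cst 0); last by apply/funext => t; rewrite big_nil.
  split; first exact: measurable_cst.
  rewrite (_ : EFin \o _ = cst 0%E); first exact: integrable0.
  by apply/funext => t /=; rewrite expr0n.
rewrite (_ : (fun t => _) = (fun t => f i t + \sum_(j <- s) f j t)).
  exact: square_integrableD.
by apply/funext => t; rewrite big_cons.
Qed.

Lemma square_integrable_continuous {R : realType} (a b : R) (f : R -> R) :
  {within `[a, b], continuous f} -> square_integrable `[a, b] f.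
Proof.
move=> cf; have mf : measurable_fun `[a, b] f by exact: subspace_continuous_measurable_fun.
have [C C0 HC] := within_continuous_bounded _ cf.
split => //; apply: measurable_bounded_integrable => //.
- rewrite [X in (X < _)%E](lebesgue_measure_itv `[a, b] : _ = _) /=.
  by case: ifPn => _; rewrite -?EFinB ltry.
- exact: measurable_funX.
exists (C ^+ 2); split; first exact: num_real.
move=> M CM t /=; rewrite in_itv /= => /HC fC.
by rewrite normrX (le_trans _ (ltW CM)) // lerXn2r // nnegrE ltW.
Qed.

Lemma square_integrable_mulmx {R : realType} (D : set R) (m n : nat) (A : 'M[R]_(m, n))
    (v : R -> 'cV[R]_n) : measurable D ->
  (forall i, square_integrable D (fun t => v t i 0)) ->
  forall i, square_integrable D (fun t => (A *m v t) i 0).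
Proof.
move=> mD sv i.
rewrite (_ : (fun t => _) = (fun t => \sum_j A i j * v t j 0)).
  by apply: square_integrable_sum => // j; exact: square_integrableZ.
by apply/funext => t; rewrite mxE.
Qed.

Lemma integrable_quad {R : realType} (D : set R) (n : nat) (M : 'M[R]_n)
    (z : R -> 'cV[R]_n) : measurable D ->
  (forall i, square_integrable D (fun t => z t i 0)) ->
  (@lebesgue_measure R).-integrable D (EFin \o (fun t => quad M (z t))).
Proof.
move=> mD sz.
rewrite (_ : (fun t => _) = (fun t => \sum_i z t i 0 * (M *m z t) i 0)).
  apply: integrable_EFin_sum => // i; apply: square_integrable_mul => //.
  exact: square_integrable_mulmx.
by apply/funext => t; rewrite /quad -mulmxA mxE; apply: eq_bigr => i _; rewrite !mxE.
Qed.

Lemma sqvE {R : realType} (n : nat) (v : 'cV[R]_n) : sqv v = \sum_i v i 0 ^+ 2.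
Proof. by rewrite /sqv mxE; apply: eq_bigr => i _; rewrite mxE expr2. Qed.

Lemma sqv_ge0 {R : realType} (n : nat) (v : 'cV[R]_n) : 0 <= sqv v.
Proof. by rewrite sqvE; apply: sumr_ge0 => i _; exact: sqr_ge0. Qed.

Lemma measurable_sqv {R : realType} (D : set R) (n : nat) (v : R -> 'cV[R]_n) :
  signal_measurable D v -> measurable_fun D (fun t => sqv (v t)).
Proof.
move=> mv; rewrite (_ : (fun t => _) = (fun t => \sum_i v t i 0 ^+ 2)).
  by apply: measurable_sum => i; apply: measurable_funX; exact: mv.
by apply/funext => t; rewrite sqvE.
Qed.

Lemma L2_integrable_sqv {R : realType} (D : set R) (n : nat) (v : R -> 'cV[R]_n) :
  L2 D v -> (@lebesgue_measure R).-integrable D (EFin \o (fun t => sqv (v t))).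
Proof.
move=> [mv finv]; apply/integrableP; split.
  by apply/measurable_EFinP; exact: measurable_sqv.
apply: le_lt_trans finv; rewrite le_eqVlt; apply/orP; left; apply/eqP.
by apply: eq_integral => t _ /=; rewrite ger0_norm ?sqv_ge0.
Qed.

Lemma L2_square_integrable {R : realType} (D : set R) (n : nat) (v : R -> 'cV[R]_n) :
  measurable D -> L2 D v -> forall i, square_integrable D (fun t => v t i 0).
Proof.
move=> mD hv i; have [mv _] := hv; split; first exact: mv.
apply: le_integrable (L2_integrable_sqv _ _ _ hv) => //.
  by apply/measurable_EFinP; apply: measurable_funX; exact: mv.
move=> t _ /=; rewrite lee_fin !ger0_norm ?sqv_ge0 ?sqr_ge0 //.
by rewrite sqvE (bigD1 i) //= lerDl; apply: sumr_ge0 => j _; exact: sqr_ge0.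
Qed.

Lemma L2_sub {R : realType} (D E : set R) (n : nat) (v : R -> 'cV[R]_n) :
  measurable D -> measurable E -> E `<=` D -> L2 D v -> L2 E v.
Proof.
move=> mD mE ED [mv finv]; split.
  by move=> i; apply: (measurable_funS mD ED); exact: mv.
apply: le_lt_trans finv; apply: ge0_subset_integral => //.
  by apply/measurable_EFinP; exact: measurable_sqv.
by move=> t _; rewrite lee_fin sqv_ge0.
Qed.

Lemma L2_trunc {R : realType} (T : R) (n : nat) (v : R -> 'cV[R]_n) :
  L2 `[0, T] v -> L2 `[0, +oo[ (trunc T v).
Proof.
move=> [mv finv].
have sub : `[0, +oo[%classic `&` `[0, T]%classic = `[0, T]%classic :> set R.
  apply/seteqP; split => [t []//|t tT]; split => //.
  by move: tT; rewrite /= !in_itv /= andbT => /andP[].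
split.
  move=> i; rewrite (_ : (fun t => _) = (fun t => v t i 0) \_ `[0, T]%classic).
    by apply/measurable_restrict => //; rewrite sub; exact: mv.
  by apply/funext => t; rewrite /trunc /patch; case: ifP => // _; rewrite mxE.
rewrite [X in (X < _)%E](_ : _ = \int[@lebesgue_measure R]_(t in `[0%R, T]) (sqv (v t))%:E)%E //.
rewrite -[in RHS]sub integral_mkcondr; apply: eq_integral => t _.
rewrite /trunc /patch; case: ifP => // _.
by rewrite sqvE big1 // => i _; rewrite mxE expr0n.
Qed.

(** The norm is an extended real; the integral being finite, the comparison moves to real numbers,
    where the square root is monotone. *)
Lemma disturbance_energy {R : realType} (n : nat) (T r : R) (d : R -> 'cV[R]_n) : 0 < r ->
  disturbance T r d ->
  \int[@lebesgue_measure R]_(t in `[0, T]) sqv (d t) < r ^+ 2.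
Proof.
move=> r0 [hd dr]; rewrite ltNge; apply/negP => rd.
have fin : ((\int[@lebesgue_measure R]_(t in `[0%R, T]) (sqv (d t))%:E) \is a fin_num)%E.
  by apply: integrable_fin_num => //; exact: L2_integrable_sqv.
have := dr; rewrite /L2norm -(fineK fin) poweR_EFin lte_fin ltNge => /negP; apply.
have : (r ^+ 2) `^ 2^-1 = r.
  by rewrite -powR_mulrn ?ltW // -powRrM mulfV ?powRr1 ?ltW.
move=> <-; apply: ge0_ler_powR => //; rewrite ?nnegrE ?sqr_ge0 //.
exact: le_trans (sqr_ge0 r) rd.
Qed.

(** * The extended trajectory *)

Lemma is_derive_col_mx {R : realFieldType} {V : normedModType R} {m n : nat}
    (f : V -> 'cV[R]_m) (g : V -> 'cV[R]_n) df dg (t v : V) :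
  is_derive t v f df -> is_derive t v g dg ->
  is_derive t v (fun s => col_mx (f s) (g s)) (col_mx df dg).
Proof.
move=> Hf Hg; apply: is_derive_mx => i j.
case: (split_ordP i) => a ->.
  rewrite (_ : (fun s => _) = (fun s => f s a j)); last first.
    by apply/funext => s; rewrite col_mxEu.
  by rewrite col_mxEu; exact: is_derive_coord.
rewrite (_ : (fun s => _) = (fun s => g s a j)); last first.
  by apply/funext => s; rewrite col_mxEd.
by rewrite col_mxEd; exact: is_derive_coord.
Qed.

Lemma normr_col_mx_le {R : realType} {m n p : nat} (A : 'M[R]_(m, p)) (B : 'M[R]_(n, p)) :
  `|col_mx A B| <= `|A| + `|B|.
Proof.
rewrite [leLHS]/Num.norm /= mx_normrE; apply: bigmax_le => [|[i j] _ /=].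
  by rewrite addr_ge0.
case: (split_ordP i) => a ->; rewrite ?col_mxEu ?col_mxEd.
  by rewrite (le_trans (normmx_entry_le _ _ _)) // lerDl.
by rewrite (le_trans (normmx_entry_le _ _ _)) // lerDr.
Qed.

Lemma ac_col_mx {R : realType} {a b : R} {m n : nat} (f : R -> 'cV[R]_m) (g : R -> 'cV[R]_n) :
  abs_continuous a b f -> abs_continuous a b g ->
  abs_continuous a b (fun t => col_mx (f t) (g t)).
Proof.
move=> acf acg; apply: (ac_dominated 1 _ _ _ acf acg) => s t _ _ _.
by rewrite mul1r opp_col_mx add_col_mx normr_col_mx_le.
Qed.

(** A continuation argument without a first exit time: the induction runs on the bound over all of
    [0, t], [step] adds the point [t], and continuity a neighbourhood of it. *)
Lemma ac_bound_until_exit {R : realType} (T c : R) (phi : R -> R) : 0 <= T ->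
  {within `[0, T], continuous phi} ->
  (forall t, 0 <= t <= T -> (forall s, 0 <= s < t -> phi s < c) -> phi t < c) ->
  forall t, 0 <= t <= T -> phi t < c.
Proof.
move=> T0 cphi step.
suff : forall s, 0 <= s <= T -> phi s < c by [].
apply: (real_induction (fun t => forall s, 0 <= s <= t -> phi s < c) T0).
  move=> s /le_anti <-; apply: step; first by rewrite lexx.
  by move=> u /andP[u0 /(le_lt_trans u0)]; rewrite ltxx.
move=> t t0T.
have [below|] := pselect (forall s, 0 <= s < t -> phi s < c); last first.
  move=> /existsNP[s0 /not_implyP[/andP[s00 s0t] ns0]].
  (* If the bound already fails at some s0 < t, this window admits only s > s0, where the induction
     hypothesis is contradictory. *)
  exists (t - s0); first by rewrite subr_gt0.
  move=> s s' _ _; rewrite opprB addrCA subrr addr0 => s0s _ Hs.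
  by exfalso; apply: ns0; apply: Hs; rewrite s00 ltW.
have phit : phi t < c by apply: step.
have /subspace_continuousP/(_ t) := cphi; rewrite /= in_itv /= => /(_ t0T).
move=> /cvgrPdist_lt /(_ (c - phi t)); rewrite subr_gt0 => /(_ phit).
rewrite near_withinE => /nbhs_ballP[e /= e0 He].
exists e => // s s' /andP[s0 st] /andP[ts' s'T] es s'e Hs u /andP[u0 us'].
have [us|su] := leP u s; first by apply: Hs; rewrite u0.
have ub : ball t e u by rewrite /ball /= ltr_norml; apply/andP; split; lra.
have uT : `[0, T]%classic u by rewrite /= in_itv /= u0 (le_trans us').
by have := He u ub uT; rewrite /from_subspace ltr_distlC => /andP[_]; lra.
Qed.

Lemma exists_filter_state {R : realType} {nv nw nz npsi : nat} (Psi : lti R nv nw nz npsi)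
    (T : R) (v : R -> 'cV[R]_nv) (w : R -> 'cV[R]_nw) : 0 <= T ->
  L2 `[0, T] v -> L2 `[0, T] w -> exists x, filter_state Psi T v w x.
Proof.
move=> T0 hv hw.
have [|x [x0 hx]] := linear_ode_solution T (Apsi Psi)
  (fun t => B1psi Psi *m v t + B2psi Psi *m w t) T0.
  move=> i.
  have sq : square_integrable `[0, T] (fun t => (B1psi Psi *m v t) i 0 + (B2psi Psi *m w t) i 0).
    by apply: square_integrableD => //; apply: square_integrable_mulmx => // j;
      exact: L2_square_integrable.
  (* On a bounded interval the constant 1 is square integrable, so multiplying by it turns an L2
     input into an integrable one. *)
  have sq1 : square_integrable `[0, T] (cst 1 : R -> R).
    by apply: square_integrable_continuous; apply: continuous_subspaceT => t; exact: cvg_cst.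
  have := square_integrable_mul _ _ _ _ sq1 sq.
  rewrite (_ : (fun t => cst 1 t * _) =
    (fun t => (B1psi Psi *m v t + B2psi Psi *m w t) i 0)).
    by apply.
  by apply/funext => t; rewrite /= mul1r [RHS]mxE.
exists x; split => //.
by rewrite (_ : (fun t => _) =
    (fun t => Apsi Psi *m x t + (B1psi Psi *m v t + B2psi Psi *m w t))) //;
  apply/funext => t; rewrite addrA.
Qed.

Theorem theorem1 (R : realType) (nG nu nd nv nw nz npsi np : nat)
    (G : nominal R nG nu nd nv nw)
    (Delta : (R -> 'cV[R]_nv) -> (R -> 'cV[R]_nw))
    (hDelta : bounded_causal Delta)
    (T r gamma : R) (hT : 0 < T) (hr : 0 < r)
    (XT : set 'cV[R]_nG) (P : 'M[R]_(np, nu)) (b : 'cV[R]_np)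
    (Psi : lti R nv nw nz npsi) (hPsi : RHinf_mx (transfer Psi))
    (M : 'M[R]_nz) (hM : M^T = M)
    (hIQC : hard_IQC T Psi M Delta)
    (V : R -> 'cV[R]_(nG + npsi) -> R) (hV : C1 V)
    (k : R -> 'cV[R]_nG -> 'cV[R]_nu) (hk : admissible_law k)
    (hdiss : forall (t : R) (x : 'cV[R]_(nG + npsi))
        (w : 'cV[R]_nw) (d : 'cV[R]_nd),
      0 <= t <= T -> V t x <= gamma + r ^+ 2 ->
      derive1 (fun s => V s x) t
        + 'd (V t) x (Fext G Psi x w d (k t (usubmx x)))
        + quad M (Hext G Psi x w d) <= sqv d)
    (hterm : forall xpsi : 'cV[R]_npsi,
      [set xG | V T (col_mx xG xpsi) <= gamma + r ^+ 2] `<=` XT)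
    (hctrl : forall (i : 'I_np) (t : R) (x : 'cV[R]_(nG + npsi)),
      0 <= t <= T -> V t x <= gamma + r ^+ 2 ->
      (row i P *m k t (usubmx x)) 0 0 <= b i 0) :
  let Omega0 := [set xi : 'cV[R]_nG | V 0 (col_mx xi 0) <= gamma] in
  Omega0 `<=` BRS_under T XT (polytope P b) r G Delta k /\
  Omega0 `<=` BRS T XT (polytope P b) r G Delta.
Proof.
set mu := @lebesgue_measure R.
have T0 : 0 <= T := ltW hT.
have under : [set xi : 'cV[R]_nG | V 0 (col_mx xi 0) <= gamma] `<=`
    BRS_under T XT (polytope P b) r G Delta k.
  move=> xi /= hxi d xG v w hd [xG0 [acG dG] [Lv _] vE wE].
  set v' := trunc T v; set w' := Delta v'.
  have Lv' : L2 `[0, +oo[ v' by exact: L2_trunc.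
  have Lw' : L2 `[0, +oo[ w' by have [+ _ _] := hDelta; exact.
  have sub : (`[0, T]%classic : set R) `<=` `[0, +oo[.
    by move=> t; rewrite /= !in_itv /= andbT => /andP[].
  have LvT : L2 `[0, T] v' := L2_sub _ _ _ _ (measurable_itv _) (measurable_itv _) sub Lv'.
  have LwT : L2 `[0, T] w' := L2_sub _ _ _ _ (measurable_itv _) (measurable_itv _) sub Lw'.
  have [xp [xp0 [acp dp]]] := exists_filter_state Psi T v' w' T0 LvT LwT.
  have iqc := hIQC v' xp Lv' (conj xp0 (conj acp dp)).
  pose x t := col_mx (xG t) (xp t).
  have acx : abs_continuous 0 T x by exact: ac_col_mx.
  pose z t := lti_out Psi (xp t) (v' t) (w' t).
  have intd : mu.-integrable `[0, T] (EFin \o (fun t => sqv (d t))).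
    by apply: L2_integrable_sqv; case: hd.
  have intz : mu.-integrable `[0, T] (EFin \o (fun t => quad M (z t))).
    apply: integrable_quad => // i.
    have sqp j : square_integrable `[0, T] (fun t => xp t j 0).
      apply: square_integrable_continuous; apply: ac_continuous.
      apply: (ac_dominated 1 _ _ _ acp acp) => s t _ _ _; rewrite mul1r.
      have := normmx_entry_le (xp t - xp s) j 0; rewrite !mxE => /le_trans; apply.
      by rewrite lerDl.
    have -> : (fun t => z t i 0) = (fun t => (Cpsi Psi *m xp t) i 0 +
        (D1psi Psi *m v' t) i 0 + (D2psi Psi *m w' t) i 0).
      by apply/funext => t; rewrite /z /lti_out [LHS]mxE [X in X + _ = _]mxE.
    apply: square_integrableD => //; [apply: square_integrableD => //|];
      by apply: square_integrable_mulmx => // j; exact: L2_square_integrable.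
  (* The rate allowed by the dissipation inequality, set to zero outside [0, T] to be integrable on
     the line. *)
  pose phi := (fun t => sqv (d t) - quad M (z t)) \_ `[0, T]%classic.
  have intphi : mu.-integrable setT (EFin \o phi).
    have : mu.-integrable `[0, T] (EFin \o (fun t => sqv (d t) - quad M (z t))).
      rewrite (_ : EFin \o _ =
        ((EFin \o (fun t => sqv (d t))) \- (EFin \o (fun t => quad M (z t))))%E) //.
      exact: integrableB.
    by rewrite integrable_mkcond // restrict_EFin.
  have energy t : 0 <= t <= T ->
      \int[mu]_(s in `[0, t]) phi s <= \int[mu]_(s in `[0, T]) sqv (d s).
    move=> /andP[t0 tT].
    have st : (`[0, t]%classic : set R) `<=` `[0, T].
      by move=> s; rewrite /= !in_itv /= => /andP[-> /le_trans]; exact.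
    have intdt : mu.-integrable `[0, t] (EFin \o (fun s => sqv (d s))).
      exact: integrableS intd.
    have intzt : mu.-integrable `[0, t] (EFin \o (fun s => quad M (z s))).
      exact: integrableS intz.
    rewrite (@eq_Rintegral _ _ _ mu _ (fun s => sqv (d s) - quad M (z s))); last first.
      by move=> s; rewrite inE => /st sT; rewrite /phi patchE mem_set.
    rewrite RintegralB //.
    (* Here the hardness of the IQC enters: nonnegativity at the intermediate time [t], not only at
       [T]. *)
    have quad_ge0 : 0 <= \int[mu]_(s in `[0, t]) quad M (z s).
      by apply: fine_ge0; apply: iqc; rewrite t0.
    apply: (@le_trans _ _ (\int[mu]_(s in `[0, t]) sqv (d s))); first by rewrite gerBl.
    rewrite /Rintegral fine_le //.
    - exact: integrable_fin_num.
    - exact: integrable_fin_num.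
    apply: ge0_subset_integral => //.
      by case/integrableP : intd.
    by move=> s _; rewrite lee_fin sqv_ge0.
  have level : forall t, 0 <= t <= T -> V t (x t) < gamma + r ^+ 2.
    have acV : abs_continuous 0 T (fun t => V t (x t)) by exact: ac_C1_graph.
    apply: (ac_bound_until_exit T _ (fun t => V t (x t)) T0 (ac_continuous _ acV)).
    move=> t /andP[t0 tT] below.
    have V0 : V 0 (x 0) <= gamma by rewrite /x xG0 xp0.
    (* Excess of V over the energy allowed up to time s; its derivative is nonpositive wherever
       dissipation applies. *)
    pose h s := V s (x s) - \int[mu]_(u in `[0, s]) phi u.
    have ach : abs_continuous 0 t h.
      have acI := ac_Rintegral 0 T _ intphi.
      apply: (ac_subitv _ (lexx 0) tT).
      apply: (ac_dominated 1 _ _ _ acV acI) => s u _ _ _.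
      rewrite mul1r (le_trans _ (ler_normB _ _)) // le_eqVlt; apply/orP; left; apply/eqP.
      by congr Num.norm; rewrite /h; ring.
    have : h t <= h 0.
      apply: (ac_ae_nonincreasing _ t0 ach).
      have dI := is_derive_Rintegral 0 _ intphi.
      have [dW _] := hV.
      (* One set of full measure for five facts: the derivatives of the integral, of [xG] and of
         [xp], and the two identities that let the true v and w replace the filter inputs. *)
      apply: (@filterS _ _ lebesgue_ae_filter _ _ _
        (filterI dI (filterI dG (filterI dp (filterI vE wE))))) =>
        s [dIs [dGs [dps [vEs wEs]]]] /andP[s0 st].
      have s0T : 0 <= s <= T by rewrite (ltW s0) (le_trans (ltW st)).
      have sI : `[0, T]%classic s by rewrite /= in_itv.
      have v'E : v' s = hG G (xG s) (w s) (d s).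
        by rewrite /v' /trunc /patch mem_set //; exact: vEs.
      have w'E : w' s = w s by rewrite (wEs sI).
      have zE : z s = Hext G Psi (x s) (w s) (d s).
        by rewrite /Hext /x col_mxKu col_mxKd /z v'E w'E.
      have dx : is_derive s (1 : R) x (Fext G Psi (x s) (w s) (d s) (k s (usubmx (x s)))).
        rewrite /Fext /x col_mxKu col_mxKd -v'E -w'E.
        by apply: is_derive_col_mx (dps s0T); rewrite w'E; exact: dGs.
      have dV := is_derive_diff_comp _ _ _ _ (is_derive_graph _ _ _ dx) (dW (s, x s)).
      exists ('d (fun p : R * 'cV[R]_(nG + npsi) => V p.1 p.2) (s, x s)
          (1, Fext G Psi (x s) (w s) (d s) (k s (usubmx (x s)))) - phi s).
        rewrite diff_partials // /phi patchE mem_set // zE.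
        (* Only times s < t occur, and there [below] supplies the level condition. *)
        have := hdiss s (x s) (w s) (d s) s0T (ltW (below s _)).
        by rewrite (ltW s0) st => /(_ isT); lra.
      exact: is_deriveB dV (dIs s0).
    rewrite /h set_itv1 Rintegral_set1 subr0 lerBlDr => /le_lt_trans; apply.
    apply: ler_ltD V0 (le_lt_trans (energy t _) (disturbance_energy _ _ _ _ hr hd)).
    by rewrite t0.
  split.
    move=> t t0T i; have := hctrl i t (x t) t0T (ltW (level t t0T)).
    by rewrite /x col_mxKu -row_mul mxE.
  apply: (hterm (xp T)); rewrite /=; apply: ltW; apply: level.
  by rewrite T0 lexx.
split; first exact: under.
(* The law [k] itself is the control witnessing membership in [BRS]. *)
by move=> xi /under Hxi; exists k.
Qed.
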